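(* Let $r \ge 2$ be an integer and $\ell \in \{1,\dots,r-1\}$. There exist positive constants $c_1$ and $c_2$ (depending only on $r$ and $\ell$) such that the following holds for every positive integer $n$ and every $r$-uniform hypergraph $G$ on at most $n$ vertices satisfying $\Delta_{\ell+1}(G) = 1$. (i) Any locally $\frac{c_1 n^{r-\ell}}{\Delta_1(G)\Delta_{\ell}(G)}$-bounded coloring of $K_n^{(r)}$ is $G$-proper. (ii) Any globally $\frac{c_2 n^{r-\ell}}{\Delta_1(G)\Delta_{\ell}(G)}$-bounded coloring of $K_n^{(r)}$ is $G$-rainbow.
   Context: $K_n^{(r)}$ is the complete $r$-uniform hypergraph on $n$ vertices. For a hypergraph $H$ and a set $S\subset V(H)$, the degree $d_H(S)$ is the number of edges of $H$ containing $S$; the maximum $j$-degree of $H$ is $\Delta_j(H) = \max\{d_H(S): S\subset V(H),\ |S| = j\}$. A coloring of $H$ is an arbitrary map $c: E(H)\to\mathbb{N}$. For a real number $k$, a coloring $c$ is locally $k$-bounded if each vertex is contained in at most $k$ edges of any given color, and globally $k$-bounded if each color is used on at most $k$ edges. A copy of $G$ in $H$ is a subhypergraph of $H$ isomorphic to $G$; it is properly colored if any two distinct edges of it with nonempty intersection receive different colors, and rainbow if all its edges receive pairwise different colors. A coloring of $H$ is $G$-proper (resp. $G$-rainbow) if it contains a properly colored (resp. rainbow) copy of $G$. *)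

(* Defs.v *)
From mathcomp Require Import all_boot all_order all_algebra.
From mathcomp Require Import reals.

Set Implicit Arguments.
Unset Strict Implicit.
Unset Printing Implicit Defensive.

Import Order.TTheory GRing.Theory Num.Theory.

(* The vertex set is a subset of an ambient finite type, so that a hypergraph
   and its subhypergraphs live in the same type. *)
Record hypergraph (T : finType) := Hypergraph {
  verts : {set T};
  edges : {set {set T}};
  edges_sub : forall e : {set T}, e \in edges -> e \subset verts
}.

Definition complete_hypergraph (r n : nat) : hypergraph 'I_n :=
  @Hypergraph 'I_n [set: 'I_n] [set e : {set 'I_n} | #|e| == r]
    (fun e _ => subsetT e).

Definition uniform (T : finType) (r : nat) (H : hypergraph T) : Prop :=
  forall e : {set T}, e \in edges H -> #|e| = r.

Definition degree (T : finType) (H : hypergraph T) (S : {set T}) : nat :=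
  #|[set e in edges H | S \subset e]|.

Definition max_degree (T : finType) (j : nat) (H : hypergraph T) : nat :=
  \max_(S : {set T} | (S \subset verts H) && (#|S| == j)) degree H S.

Definition subhypergraph (T : finType) (F H : hypergraph T) : Prop :=
  verts F \subset verts H /\ edges F \subset edges H.

Definition isomorphic (T U : finType) (G : hypergraph T) (F : hypergraph U) :
    Prop :=
  exists f : T -> U,
    [/\ {in verts G &, injective f},
        f @: verts G = verts F
      & [set f @: (e : {set T}) | e in edges G] = edges F].

Definition copy_in (T U : finType) (G : hypergraph T) (H F : hypergraph U) :
    Prop :=
  subhypergraph F H /\ isomorphic G F.

(* A coloring of H is a total map on sets of vertices; everything below only
   looks at its values on edges of H, so this is the same as a map from
   E(H) to nat. *)
Definition coloring (T : finType) := {set T} -> nat.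

Definition locally_bounded (R : realType) (T : finType) (k : R)
    (H : hypergraph T) (c : coloring T) : Prop :=
  forall (v : T) (a : nat), v \in verts H ->
    (#|[set e in edges H | (v \in e) && (c e == a)]|%:R <= k)%R.

Definition globally_bounded (R : realType) (T : finType) (k : R)
    (H : hypergraph T) (c : coloring T) : Prop :=
  forall a : nat, (#|[set e in edges H | c e == a]|%:R <= k)%R.

Definition properly_colored (T : finType) (F : hypergraph T)
    (c : coloring T) : Prop :=
  forall e1 e2 : {set T}, e1 \in edges F -> e2 \in edges F ->
    e1 <> e2 -> e1 :&: e2 <> set0 -> c e1 <> c e2.

Definition rainbow (T : finType) (F : hypergraph T) (c : coloring T) : Prop :=
  forall e1 e2 : {set T}, e1 \in edges F -> e2 \in edges F ->
    e1 <> e2 -> c e1 <> c e2.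

Definition G_proper (T U : finType) (G : hypergraph T) (H : hypergraph U)
    (c : coloring U) : Prop :=
  exists F : hypergraph U, copy_in G H F /\ properly_colored F c.

Definition G_rainbow (T U : finType) (G : hypergraph T) (H : hypergraph U)
    (c : coloring U) : Prop :=
  exists F : hypergraph U, copy_in G H F /\ rainbow F c.

(* Main.v *)
Require Import Defs.
From mathcomp Require Import all_boot all_order all_algebra.
From mathcomp Require Import reals.
From mathcomp Require Import all_fingroup ring lra zify.

Set Implicit Arguments.
Unset Strict Implicit.
Unset Printing Implicit Defensive.

Import Order.TTheory GRing.Theory Num.Theory.
Local Open Scope ring_scope.

(** Embed the vertices of [G] in [{0, .., n-1}] and apply a uniformly random
    permutation [s].  For edges [e, e'] of [G], call the images [s e, s e'] in
    conflict when they have the same colour (and intersect, in the proper case).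
    The bad events are "[s] extends [M]" for the partial injections [M] with
    domain [e :|: e'] and image a conflicting pair; such an event has probability
    [1 / n ^_ #|M|].  Two events with disjoint domains and disjoint images are
    negatively dependent (Lu and Szekely), as shown by composing with
    transpositions, so the lopsided local lemma applies once the probabilities
    of the events through a given pair [(x, y)] add up to [O(1 / n)].
    With [K] bounding the number of conflicts of one [r]-set, this sum is
    [O(K n^(-r-1))] times the sum of [n^#|e :&: e'|] over the pairs [e, e'] with
    [e] through [x].  Double counting gives
    [n^#|S| * degree S <= n^l * max_degree l] for [#|S| <= l], and distinct edges
    meet in at most [l] vertices, so that last sum is
    [O(max_degree 1 * n^l * max_degree l)]. *)

(** * Inequalities between finite sums *)

Lemma ler_sum_subpred (R : numDomainType) (I : finType) (P Q : pred I) (F : I -> R) :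
  subpred P Q -> (forall i, 0 <= F i) -> \sum_(i | P i) F i <= \sum_(i | Q i) F i.
Proof.
move=> PQ F0; rewrite [leRHS](bigID P) /= (eq_bigl P) ?lerDl ?sumr_ge0 //.
by move=> i; case Pi: (P i); rewrite ?andbF ?(PQ _ Pi).
Qed.

(** A union bound: each [i] is charged to some witness [j], and multiple charges only enlarge the
    right side since [F] is nonnegative. *)
Lemma ler_sum_cover (R : numDomainType) (I J : finType) (P : pred I) (Q : pred J)
    (S : I -> J -> bool) (F : I -> R) :
  (forall i, P i -> exists2 j, Q j & S i j) -> (forall i, 0 <= F i) ->
  \sum_(i | P i) F i <= \sum_(j | Q j) \sum_(i | S i j) F i.
Proof.
move=> cov F0; rewrite (exchange_big_dep predT) //= [leRHS](bigID P) /=.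
apply: le_trans (_ : \sum_(i | P i) \sum_(j | Q j && S i j) F i <= _); last first.
  by rewrite lerDl sumr_ge0 // => i _; apply: sumr_ge0.
apply: ler_sum => i /cov[j Qj Sij].
by rewrite (bigD1 j) ?Qj //= lerDl sumr_ge0.
Qed.

(** Splitting according to which component satisfies [P] gives two sums, equal by symmetry of [Q]
    and [g]. *)
Lemma ler_sum_pair_sym (R : numDomainType) (I : finType) (Q : rel I) (P : pred I)
    (g : I -> I -> R) :
  symmetric Q -> (forall a b, g a b = g b a) -> (forall a b, 0 <= g a b) ->
  \sum_(q : I * I | Q q.1 q.2 && (P q.1 || P q.2)) g q.1 q.2 <=
    2 * \sum_(a | P a) \sum_(b | Q a b) g a b.
Proof.
move=> Qs gs g0.
rewrite (eq_bigr (fun q : I * I => (fun a b => g a b) q.1 q.2)) //.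
rewrite -(pair_big_dep predT (fun a b => Q a b && (P a || P b)) g) /=.
apply: le_trans (_ : \sum_a \sum_(b | Q a b && P a) g a b +
    \sum_a \sum_(b | Q a b && P b) g a b <= _).
  rewrite -big_split /=; apply: ler_sum => a _.
  rewrite big_mkcond [X in _ <= X + _]big_mkcond [X in _ <= _ + X]big_mkcond.
  rewrite -big_split /=; apply: ler_sum => b _.
  by have := g0 a b; case: (Q a b); case: (P a); case: (P b) => //= h;
    rewrite ?addr0 ?add0r // lerDl.
have e1 : \sum_a \sum_(b | Q a b && P a) g a b = \sum_(a | P a) \sum_(b | Q a b) g a b.
  rewrite [RHS]big_mkcond; apply: eq_bigr => a _; case: (P a).
    by apply: eq_bigl => b; rewrite andbT.
  by rewrite big_pred0 // => b; rewrite andbF.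
suff -> : \sum_a \sum_(b | Q a b && P b) g a b = \sum_a \sum_(b | Q a b && P a) g a b.
  by rewrite e1 mulr_natl mulr2n.
rewrite (exchange_big_dep predT) //=; apply: eq_bigr => a _.
by apply: eq_big => [b|b _]; [rewrite Qs | rewrite gs].
Qed.

(** * The lopsided local lemma, in counting form *)

Definition avoiding (O I : finType) (A : I -> {set O}) (S : {set I}) : {set O} :=
  [set w | [forall i in S, w \notin A i]].

(* By induction on [S], [P(A i | avoiding S) <= 2 * p i]. *)
Lemma lopsided_local_lemma (R : realFieldType) (O I : finType) (F : {set I})
    (A : I -> {set O}) (p : I -> R) (nb : rel I) :
  (0 < #|O|)%N ->
  (forall i, 0 <= p i) ->
  {in F, forall i, nb i i} ->
  {in F, forall i, \sum_(j in F | nb i j) p j <= 4^-1} ->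
  (forall (i : I) (S : {set I}), i \in F -> S \subset F ->
     {in S, forall j, ~~ nb i j} ->
     #|A i :&: avoiding A S|%:R <= p i * #|avoiding A S|%:R) ->
  exists w, {in F, forall i, w \notin A i}.
Proof.
move=> O0 p0 nbxx hsum; set avoid := avoiding A => hind.
have avoidS (S S' : {set I}) : S \subset S' -> avoid S' \subset avoid S.
  move=> sSS'; apply/subsetP=> w; rewrite !inE => /'forall_implyP wS'.
  by apply/'forall_implyP=> i iS; apply: wS'; apply: (subsetP sSS').
have avoidU (S S' : {set I}) : #|avoid S|%:R <=
    #|avoid (S :|: S')|%:R + \sum_(j in S') #|A j :&: avoid S|%:R :> R.
  rewrite -natr_sum -natrD ler_nat.
  have sub : avoid S \subset
      avoid (S :|: S') :|: \bigcup_(j in S') (A j :&: avoid S).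
    apply/subsetP=> w wS; rewrite in_setU orbC -implyNb; apply/implyP=> /bigcupP wS'.
    move: (wS); rewrite !inE => /'forall_implyP wS1.
    apply/'forall_implyP=> i; rewrite inE => /orP[/wS1 //|iS'].
    by apply/negP=> wi; apply: wS'; exists i => //; rewrite inE wi.
  apply: leq_trans (subset_leq_card sub) _.
  apply: leq_trans (leq_card_setU _ _) _; rewrite leq_add2l.
  elim/big_rec2: _ => [|i s T _ IH]; first by rewrite cards0.
  by apply: leq_trans (leq_card_setU _ _) _; rewrite leq_add2l.
have key m (S : {set I}) i : (#|S| < m)%N -> S \subset F -> i \in F ->
    #|A i :&: avoid S|%:R <= 2 * p i * #|avoid S|%:R.
  elim: m S i => // m IH S i Sm SF iF.
  pose S1 := [set j in S | nb i j]; pose S2 := S :\: S1.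
  have S2S : S2 \subset S by apply: subsetDl.
  have S2F : S2 \subset F by apply: subset_trans SF.
  have SE : S = S2 :|: S1.
    by apply/setP=> j; rewrite !inE; case: (j \in S); case: (nb i j).
  have hS2 : #|A i :&: avoid S2|%:R <= p i * #|avoid S2|%:R.
    by apply: hind => // j; rewrite !inE => /andP[+ jS]; rewrite jS.
  have le1 : #|A i :&: avoid S|%:R <= p i * #|avoid S2|%:R.
    apply: le_trans hS2; rewrite ler_nat subset_leq_card //.
    by apply: setIS; apply: avoidS.
  (* By induction the neighbours in [S1] remove at most a fraction [2 * 4^-1] of [avoid S2], so at
     least half of it survives in [avoid S]. *)
  have le2 : #|avoid S2|%:R <= 2 * #|avoid S|%:R :> R.
    have [S10|[j0 j0S1]] := set_0Vmem S1.
      by rewrite SE S10 setU0 ler_peMl ?ler0n ?ler1n.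
    have S2m : (#|S2| < m)%N.
      rewrite ltnS in Sm; apply: leq_trans Sm; apply: proper_card.
      apply/properP; split=> //; exists j0; last by rewrite inE j0S1.
      by move: j0S1; rewrite inE => /andP[].
    have := avoidU S2 S1; rewrite -SE.
    have : \sum_(j in S1) #|A j :&: avoid S2|%:R <= 2^-1 * #|avoid S2|%:R :> R.
      apply: le_trans (_ : \sum_(j in S1) 2 * p j * #|avoid S2|%:R <= _).
        apply: ler_sum => j; rewrite inE => /andP[jS _].
        by apply: IH => //; apply: (subsetP SF).
      rewrite -mulr_suml ler_wpM2r ?ler0n // -mulr_sumr.
      apply: le_trans (_ : 2 * 4^-1 <= _); last by lra.
      rewrite ler_wpM2l //; apply: le_trans (hsum i iF).
      apply: ler_sum_subpred => // j; rewrite inE => /andP[jS ->].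
      by rewrite (subsetP SF).
    by lra.
  apply: le_trans le1 _; by rewrite [2 * p i]mulrC -mulrA ler_wpM2l.
have pos m (S : {set I}) : (#|S| < m)%N -> S \subset F -> (0 < #|avoid S|)%N.
  elim: m S => // m IH S Sm SF.
  have [->|[i iS]] := set_0Vmem S.
    rewrite (_ : avoid set0 = [set: O]) ?cardsT //.
    by apply/setP=> w; rewrite !inE; apply/'forall_implyP=> i; rewrite inE.
  have iF : i \in F by apply: (subsetP SF).
  have Dm : (#|S :\ i| < m)%N by rewrite (cardsD1 i) iS in Sm.
  have DF : S :\ i \subset F by apply: subset_trans SF; apply: subsetDl.
  have D0 := IH _ Dm DF.
  have := avoidU (S :\ i) [set i]; rewrite setUC setD1K // big_set1.
  have := key _ _ _ Dm DF iF.
  (* As [i] is its own neighbour, [p i] is a term of the bounded sum; hence [A i] removes at most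
     half of [avoid (S :\ i)]. *)
  have : p i <= 4^-1.
    apply: le_trans (hsum i iF); rewrite (bigD1 i) /=; last by rewrite iF nbxx.
    by rewrite lerDl sumr_ge0.
  rewrite -(ltr_nat R) in D0; rewrite -(ltr_nat R).
  by move: (p0 i) D0; set a := p i; set b := _%:R; nra.
have /card_gt0P[w] := pos _ F (ltnSn _) (subxx _).
by rewrite inE => /'forall_implyP; exists w.
Qed.

(** * Negative dependence for random permutations *)

Section PermutationEvents.
Variable V : finType.
Implicit Types (M : {set V * V}) (A : {set {perm V}}) (s : {perm V}).

Definition extends M s := [forall z in M, s z.1 == z.2].

Definition extensions M := [set s | extends M s].

Definition partial_injection M :=
  [forall z in M, forall z' in M, ((z.1 == z'.1) || (z.2 == z'.2)) ==> (z == z')].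

(** The neighbourhood relation fed to the local lemma. *)
Definition touch M M' :=
  [exists z in M, exists z' in M', (z.1 == z'.1) || (z.2 == z'.2)].

Lemma extendsP M s : reflect {in M, forall z, s z.1 = z.2} (extends M s).
Proof. by apply: (iffP 'forall_in_eqP) => h z /h. Qed.

Lemma partial_injectionP M : reflect
  {in M &, forall z z', z.1 = z'.1 \/ z.2 = z'.2 -> z = z'} (partial_injection M).
Proof.
apply: (iffP idP) => [/'forall_implyP h z z' zM z'M e|h].
  have /'forall_implyP/(_ z' z'M)/implyP hz := h z zM.
  by apply/eqP/hz; case: e => ->; rewrite eqxx ?orbT.
apply/'forall_implyP=> z zM; apply/'forall_implyP=> z' z'M.
by apply/implyP=> e; apply/eqP/h => //; case/orP: e => /eqP; [left|right].
Qed.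

Lemma touchPn M M' : reflect
  {in M & M', forall z z', z.1 <> z'.1 /\ z.2 <> z'.2} (~~ touch M M').
Proof.
apply: (iffP idP) => [h z z' zM z'M|h].
  by split=> e; case/negP: h; apply/exists_inP; exists z => //;
    apply/exists_inP; exists z' => //; rewrite e eqxx ?orbT.
apply/negP=> /exists_inP[z zM /exists_inP[z' z'M]].
by have [h1 h2] := h _ _ zM z'M; case/orP => /eqP.
Qed.

(* Post-composing with the transpositions [tperm y z], for the [#|V| - #|M|]
   values [z] outside the image of [M], sends the permutations extending
   [(x, y) |: M] injectively to permutations extending [M]. *)
Lemma card_extends M A : partial_injection M ->
  (forall s z v, s \in A -> z \in M -> s z.1 = z.2 -> (s * tperm z.2 v)%g \in A) ->
  (#|A :&: extensions M| * #|V| ^_ #|M| <= #|A|)%N.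
Proof.
have [m] := ubnP #|M|; elim: m M => // m IH M Mm injM clM.
have [->|[[x y] xyM]] := set_0Vmem M.
  by rewrite cards0 ffactn0 muln1 subset_leq_card // subsetIl.
have ME := cardsD1 (x, y) M; rewrite xyM in ME.
set M' := M :\ (x, y) in ME.
have M'M z : z \in M' -> z \in M by rewrite inE => /andP[].
move/partial_injectionP: injM => injM.
have injM' : partial_injection M'.
  by apply/partial_injectionP=> z z' /M'M zM /M'M z'M; apply: injM.
have M'm : (#|M'| < m)%N by rewrite ME in Mm.
have IHM := IH M' M'm injM' (fun s z v sA zM => clM s z v sA (M'M _ zM)).
apply: leq_trans IHM; rewrite ME ffactnSr mulnCA mulnC leq_mul2r; apply/orP; right.
rewrite mulnC.
pose Z := ~: [set z.2 | z in M'].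
have cZ : #|Z| = (#|V| - #|M'|)%N.
  rewrite cardsCs setCK card_in_imset // => z z' /M'M zM /M'M z'M e.
  by apply: injM => //; right.
rewrite -cZ mulnC -cardsX.
pose h (q : {perm V} * V) : {perm V} := (q.1 * tperm y q.2)%g.
have hinj : {in setX (A :&: [set s | extends M s]) Z &, injective h}.
  move=> [s v] [s' v'].
  rewrite !inE /= => /andP[/andP[_ /extendsP es] _] /andP[/andP[_ /extendsP es'] _].
  rewrite /h /= => e.
  (* Since [s x = y], the composite sends [x] to [v]; this recovers [v], and then [s]. *)
  have ev : v = v'.
    by move/permP/(_ x): (e); rewrite !permM (es _ xyM) (es' _ xyM) /= !tpermL.
  by move: e; rewrite ev => /mulIg ->.
rewrite -(card_in_imset hinj).
apply: subset_leq_card; apply/subsetP=> _ /imsetP[[s v] + ->].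
rewrite inE /= => /andP[/setIP[sA]]; rewrite inE => /extendsP es vZ.
rewrite inE (clM _ (x, y)) //=; last exact: (es _ xyM).
rewrite inE; apply/extendsP=> z zM'; rewrite permM es ?M'M // tpermD //.
  apply: contraTneq zM' => e; rewrite !inE; apply/negP=> /andP[/eqP + zM].
  by apply; apply: injM => //; right.
by apply: contraTneq vZ => /= ->; rewrite inE negbK; apply: imset_f.
Qed.

(** Composing with [tperm z.2 v] cannot create an extension of [M']: a pair of [M'] affected by the
    transposition would share its source or its target with [z]. *)
Lemma card_extends_avoid M (S : {set {set V * V}}) :
  partial_injection M -> {in S, forall M', ~~ touch M M'} ->
  (#|extensions M :&: avoiding extensions S| * #|V| ^_ #|M|
     <= #|avoiding extensions S|)%N.
Proof.
move=> injM nt; rewrite setIC; apply: card_extends => // s z v.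
rewrite !inE => /'forall_implyP sA zM sz; apply/'forall_implyP=> M' M'S.
have := sA M' M'S; rewrite !inE; apply: contraNN => /extendsP es.
apply/extendsP=> z' z'M'.
have /touchPn/(_ _ _ zM z'M')[ne1 ne2] := nt _ M'S.
have := es _ z'M'; rewrite permM; case: tpermP => [e|_ e|//].
  by case: ne1; apply: (@perm_inj _ s); rewrite sz e.
by case: ne2.
Qed.

End PermutationEvents.

(** * Elementary counting estimates *)

Lemma expn_le_ffact (n m : nat) : (m <= n -> n ^ m <= m ^ m * n ^_ m)%N.
Proof.
move=> mn; suff h j : (j <= m -> n ^ j <= m ^ j * n ^_ j)%N by apply: h.
elim: j => // j IH jm; rewrite expnS expnS ffactnSr.
(* As [j < m <= n], the factor [n - j] is at least [n / m]. *)
have h : (n <= m * (n - j))%N by nia.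
have := leq_mul h (IH (ltnW jm)); lia.
Qed.

Lemma bin_le_expn (n k : nat) : ('C(n, k) <= n ^ k)%N.
Proof.
have ffact_le : (n ^_ k <= n ^ k)%N.
  by elim: k => // k IH; rewrite ffactnSr expnSr leq_mul // leq_subr.
by apply: leq_trans ffact_le; rewrite -bin_ffact leq_pmulr ?fact_gt0.
Qed.

Lemma card_uniform_mem (V : finType) (k : nat) (y : V) :
  (#|[set f : {set V} | (#|f| == k.+1) && (y \in f)]| <= #|V| ^ k)%N.
Proof.
apply: leq_trans (bin_le_expn _ _); rewrite -card_draws.
rewrite -(card_in_imset (f := fun f : {set V} => f :\ y)) => [|f f']; last first.
  by rewrite !inE => /andP[_ yf] /andP[_ yf'] e; rewrite -(setD1K yf) e setD1K.
apply: subset_leq_card; apply/subsetP=> _ /imsetP[f + ->].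
by rewrite !inE (cardsD1 y f) => /andP[/eqP + yf]; rewrite yf add1n => -[->].
Qed.

(* A pair of [r]-sets spans at most [2 * r] vertices, so the first factor bounds
   the number of [M] inside the product of two such unions; the second one
   compares [n ^ m] with [n ^_ m] for [m <= 2 * r]. *)
Definition union_constant (r : nat) : nat := 2 ^ ((2 * r) ^ 2) * (2 * r) ^ (2 * r).

(** * Weights of the bad events and the conflict-free permutation *)

Section ConflictFree.
Variables (R : realFieldType) (n r : nat) (I : finType).
Variables (E : {set I}) (ed : I -> {set 'I_n}) (cf : rel {set 'I_n}) (W K : R).
Hypothesis r_gt0 : (0 < r)%N.
Hypothesis card_ed : {in E, forall e, #|ed e| = r}.
Hypothesis cf_sym : symmetric cf.
Hypothesis cf_bound : forall f : {set 'I_n}, #|f| = r ->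
  #|[set f' : {set 'I_n} | (#|f'| == r) && cf f f']|%:R <= K.
Hypothesis overlap_bound : forall x : 'I_n,
  \sum_(e in E | x \in ed e) \sum_(e' in E | e != e')
    n%:R ^+ #|ed e :&: ed e'| <= W.

Let pairE (e e' : I) := [&& e \in E, e' \in E & e != e'].
Let pairF (f f' : {set 'I_n}) := [&& #|f| == r, #|f'| == r & cf f f'].
(** For a partial injection the cardinality forces the domain to be all of [ed e :|: ed e']. That
    [M] carries [ed e] onto [f] is not demanded: the larger family is easier to count and costs only
    a constant. *)
Let box (e e' : I) (f f' : {set 'I_n}) (M : {set 'I_n * 'I_n}) :=
  (M \subset setX (ed e :|: ed e') (f :|: f')) && (#|M| == #|ed e :|: ed e'|).
Let bad := [set M : {set 'I_n * 'I_n} | partial_injection M &&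
  [exists q : I * I, exists f : {set 'I_n} * {set 'I_n},
     [&& pairE q.1 q.2, pairF f.1 f.2 & box q.1 q.2 f.1 f.2 M]]].
Let p (M : {set 'I_n * 'I_n}) : R := (n ^_ #|M|)%:R^-1.

Let p_ge0 M : 0 <= p M.
Proof. by rewrite invr_ge0 ler0n. Qed.

Let card_union e e' : pairE e e' ->
  (#|ed e :|: ed e'| + #|ed e :&: ed e'| = 2 * r)%N.
Proof. by case/and3P=> /card_ed h /card_ed h' _; rewrite cardsUI h h' mul2n addnn. Qed.

(** The union has [2 * r - #|ed e :&: ed e'|] elements, so a larger overlap makes a likelier event;
    this is the source of the power of [n] in the numerator. *)
Let box_sum e e' f f' : (0 < n)%N -> pairE e e' -> pairF f f' ->
  \sum_(M | box e e' f f' M) p M <=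
    (union_constant r)%:R * n%:R ^+ #|ed e :&: ed e'| / n%:R ^+ (2 * r).
Proof.
move=> n0 pe pf; have uE := card_union pe.
set i := #|ed e :&: ed e'| in uE *; set m := #|ed e :|: ed e'| in uE.
have m2r : (m <= 2 * r)%N by rewrite -uE leq_addr.
have mn : (m <= n)%N by rewrite -[leqRHS]card_ord max_card.
have n0R : 0 < n%:R :> R by rewrite ltr0n.
have pm M : box e e' f f' M -> p M <= ((2 * r) ^ (2 * r))%:R * n%:R ^+ i / n%:R ^+ (2 * r).
  case/andP=> _ /eqP mM; rewrite /p mM -/m -uE exprD invfM mulrA.
  rewrite [_ * _ / _ ^+ m]mulrAC mulfK ?expf_neq0 ?gt_eqF //.
  rewrite ler_pdivlMr ?exprn_gt0 // ler_pdivrMl ?ltr0n ?ffact_gt0 //.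
  rewrite -natrX -natrM ler_nat mulnC uE; apply: leq_trans (expn_le_ffact mn) _.
  rewrite leq_mul2r; apply/orP; right.
  apply: leq_trans (_ : (2 * r) ^ m <= _)%N; first by case: (m) m2r => // m'; rewrite leq_exp2r.
  by rewrite leq_exp2l // ; lia.
apply: le_trans (ler_sum _ pm) _.
rewrite sumr_const -[leLHS]mulr_natl /union_constant natrM -!mulrA.
rewrite ler_wpM2r ?mulr_ge0 ?invr_ge0 ?exprn_ge0 ?ler0n // ler_nat.
apply: leq_trans (_ : #|powerset (setX (ed e :|: ed e') (f :|: f'))| <= _)%N.
  by apply: subset_leq_card; apply/subsetP=> M /andP[sM _]; rewrite powersetE.
rewrite card_powerset leq_exp2l // cardsX -mulnn leq_mul //.
case/and3P: pf => /eqP hf /eqP hf' _.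
by apply: leq_trans (leq_card_setU _ _) _; rewrite hf hf' mul2n addnn.
Qed.

(** [K] bounds a cardinality as soon as some [r]-set exists; the first [r] elements of ['I_n] form
    one. *)
Let K_ge0 : (r <= n)%N -> 0 <= K.
Proof.
move=> rn; apply: le_trans (cf_bound (f := [set i in take r (enum 'I_n)]) _).
  exact: ler0n.
rewrite cardsE (card_uniqP _) ?take_uniq ?enum_uniq // size_take size_enum_ord.
by case: ltngtP rn.
Qed.

(** At most [n ^ (r - 1)] sets of size [r] contain [y], each with at most [K] conflicts; the 2
    allows [y] to lie in either set. *)
Let pairF_count y : (r <= n)%N ->
  \sum_(f : {set 'I_n} * {set 'I_n} | pairF f.1 f.2 && ((y \in f.1) || (y \in f.2))) (1 : R)
    <= 2 * (n%:R ^+ r.-1 * K).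
Proof.
move=> rn; apply: le_trans
  (ler_sum_pair_sym (Q := pairF) (fun f : {set 'I_n} => y \in f) (g := fun _ _ => 1) _ _ _) _ => //.
  by move=> f f'; rewrite /pairF cf_sym; case: (#|f| == r); rewrite ?andbF.
rewrite ler_wpM2l // (bigID (fun f : {set 'I_n} => #|f| == r)) /=.
rewrite [X in _ + X]big1 ?addr0; last first.
  move=> f /andP[_ nf]; rewrite big_pred0 // => f'.
  by rewrite /pairF (negbTE nf).
apply: le_trans (_ : \sum_(f : {set 'I_n} | (y \in f) && (#|f| == r)) K <= _).
  apply: ler_sum => f /andP[_ /eqP hf]; apply: le_trans (cf_bound hf).
  rewrite sumr_const ler_nat subset_leq_card //; apply/subsetP=> f' pf.
  by rewrite inE; case/and3P: (pf : pairF f f') => _ -> ->.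
rewrite sumr_const -[leLHS]mulr_natl ler_wpM2r ?K_ge0 // -natrX ler_nat.
apply: leq_trans (_ : #|'I_n| ^ r.-1 <= _)%N; last by rewrite card_ord.
apply: leq_trans (card_uniform_mem _ y); rewrite prednK //.
by apply: subset_leq_card; apply/subsetP=> f pf; rewrite inE andbC.
Qed.

Let pairE_sum x :
  \sum_(q : I * I | pairE q.1 q.2 && ((x \in ed q.1) || (x \in ed q.2)))
     (n%:R ^+ #|ed q.1 :&: ed q.2| : R) <= 2 * W.
Proof.
apply: le_trans (ler_sum_pair_sym (Q := pairE) (fun e => x \in ed e)
  (g := fun e e' => n%:R ^+ #|ed e :&: ed e'|) _ _ _) _.
- by move=> e e'; rewrite /pairE eq_sym andbCA.
- by move=> e e'; rewrite setIC.
- by move=> e e'; rewrite exprn_ge0.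
rewrite ler_wpM2l //; apply: le_trans (overlap_bound x).
rewrite (bigID [in E]) /= [X in _ + X]big1 ?addr0; last first.
  by move=> e /andP[_ ne]; rewrite big_pred0 // => e'; rewrite /pairE (negbTE ne).
rewrite le_eqVlt; apply/orP; left; apply/eqP; apply: eq_big => [e|e /andP[_ eE]].
  exact: andbC.
by apply: eq_bigl => e'; rewrite /pairE eE.
Qed.

Let weight (z : 'I_n * 'I_n) := \sum_(M in bad | z \in M) p M.

(** The pair of edges meeting [z.1] and the conflicting pair meeting [z.2] are summed independently,
    so the bound factors into [pairE_sum] and [pairF_count]. Their factors 2 give the 4, and
    [n ^ (r - 1) / n ^ (2 * r)] gives the denominator. *)
Let weight_le z : (r <= n)%N ->
  weight z <= 4 * (union_constant r)%:R * W * K / n%:R ^+ r.+1.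
Proof.
move=> rn; have n0 : (0 < n)%N by apply: leq_trans rn.
have n0R : 0 < n%:R :> R by rewrite ltr0n.
pose Q (t : (I * I) * ({set 'I_n} * {set 'I_n})) :=
  (pairE t.1.1 t.1.2 && ((z.1 \in ed t.1.1) || (z.1 \in ed t.1.2))) &&
  (pairF t.2.1 t.2.2 && ((z.2 \in t.2.1) || (z.2 \in t.2.2))).
apply: le_trans (ler_sum_cover (Q := Q)
  (S := fun M t => box t.1.1 t.1.2 t.2.1 t.2.2 M) _ p_ge0) _.
  move=> M /andP[]; rewrite inE => /andP[_ /existsP[q /existsP[f /and3P[pe pf bM]]]] zM.
  exists (q, f) => //; rewrite /Q pe pf /=.
  by have /andP[/subsetP/(_ z zM)] := bM; rewrite !inE => ->.
pose g (q : I * I) : R := n%:R ^+ #|ed q.1 :&: ed q.2|.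
apply: le_trans (_ : \sum_(t | Q t)
    (fun q (_ : {set 'I_n} * {set 'I_n}) =>
       (union_constant r)%:R * g q / n%:R ^+ (2 * r)) t.1 t.2 <= _).
  by apply: ler_sum => t /andP[/andP[pe _] /andP[pf _]]; apply: box_sum.
rewrite -(pair_big (fun q : I * I => pairE q.1 q.2 && ((z.1 \in ed q.1) || (z.1 \in ed q.2)))
   (fun f => pairF f.1 f.2 && ((z.2 \in f.1) || (z.2 \in f.2)))
   (fun q _ => (union_constant r)%:R * g q / n%:R ^+ (2 * r))) /=.
pose SF := \sum_(f : {set 'I_n} * {set 'I_n} |
  pairF f.1 f.2 && ((z.2 \in f.1) || (z.2 \in f.2))) (1 : R).
pose SE := \sum_(q : I * I | pairE q.1 q.2 && ((z.1 \in ed q.1) || (z.1 \in ed q.2))) g q.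
apply: le_trans (_ : (union_constant r)%:R / n%:R ^+ (2 * r) * (SE * SF) <= _).
  rewrite [X in X <= _](_ : _ = (union_constant r)%:R / n%:R ^+ (2 * r) * (SE * SF)) //.
  rewrite /SE mulr_suml mulr_sumr; apply: eq_bigr => q _.
  rewrite /SF !mulr_sumr; apply: eq_bigr => f _.
  by rewrite mulr1 mulrAC.
have SE0 : 0 <= SE by apply: sumr_ge0 => q _; rewrite exprn_ge0.
have SF0 : 0 <= SF by apply: sumr_ge0.
apply: le_trans (_ : (union_constant r)%:R / n%:R ^+ (2 * r) *
   ((2 * W) * (2 * (n%:R ^+ r.-1 * K))) <= _).
  rewrite ler_wpM2l ?divr_ge0 ?exprn_ge0 ?ler0n // ler_pM //.
    exact: pairE_sum.
  exact: pairF_count.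
rewrite le_eqVlt; apply/orP; left; apply/eqP.
have -> : (2 * r = r.+1 + r.-1)%N by rewrite addSnnS prednK // mul2n addnn.
rewrite exprD; field.
by rewrite !expf_neq0 // gt_eqF.
Qed.

Lemma exists_conflict_free_perm :
  (r <= n)%N -> (64 * r * union_constant r)%:R * W * K <= n%:R ^+ r ->
  exists s : {perm 'I_n}, {in E &, forall e e', e != e' -> ~~ cf (s @: ed e) (s @: ed e')}.
Proof.
move=> rn small; have n0 : (0 < n)%N by apply: leq_trans rn.
have n0R : 0 < n%:R :> R by rewrite ltr0n.
have badP M : M \in bad -> [/\ partial_injection M, (#|M| <= 2 * r)%N, (#|M| <= n)%N &
    M != set0].
  rewrite inE => /andP[iM /existsP[q /existsP[f /and3P[pe _ /andP[_ /eqP cM]]]]].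
  have := card_union pe; rewrite -cM => h; split=> //.
  - by rewrite -h leq_addr.
  - by rewrite cM -[leqRHS]card_ord max_card.
  rewrite -card_gt0 cM; case/and3P: pe => /card_ed h1 _ _.
  by apply: leq_trans (subset_leq_card (subsetUl _ _)); rewrite h1.
have [|||M MF|M S MF _ nt|s hs] := lopsided_local_lemma (F := bad)
    (A := @extensions _) (p := p) (nb := @touch _).
- by apply/card_gt0P; exists 1%g.
- exact: p_ge0.
- move=> M /badP[_ _ _ /set0Pn[z zM]]; apply/exists_inP; exists z => //.
  by apply/exists_inP; exists z => //; rewrite eqxx.
- have [_ M2r _ _] := badP M MF.
  (* Each neighbour of [M] is charged to a pair [t.2] in it that shares a coordinate with a pair
     [t.1] of [M]. *)
  pose Q (t : ('I_n * 'I_n) * ('I_n * 'I_n)) :=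
    (t.1 \in M) && ((t.2.1 == t.1.1) || (t.2.2 == t.1.2)).
  apply: le_trans (ler_sum_cover (Q := Q)
     (S := fun M' t => (M' \in bad) && (t.2 \in M')) _ p_ge0) _.
    move=> M' /andP[M'F /exists_inP[z zM /exists_inP[z' z'M h]]].
    exists (z, z'); rewrite /Q /= ?M'F ?z'M // zM /=.
    by rewrite [z'.1 == _]eq_sym [z'.2 == _]eq_sym.
  set b := 4 * (union_constant r)%:R * W * K / n%:R ^+ r.+1.
  apply: le_trans (ler_sum _ (fun t _ => weight_le t.2 rn)) _.
  have b0 : 0 <= b by apply: le_trans (weight_le (Ordinal n0, Ordinal n0) rn);
    apply: sumr_ge0.
  rewrite sumr_const -[leLHS]mulr_natl -/b.
  (* These [4 * r * n] charges, each of weight at most [b], total [16 * r * union_constant r * W * K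
     / n ^ r]; the 64 in the hypothesis brings this down to [4^-1]. *)
  have cQ : (#|Q| <= 2 * r * (2 * n))%N.
    rewrite -sum1_card -(pair_big_dep (fun z => z \in M)
      (fun z z' : 'I_n * 'I_n => (z'.1 == z.1) || (z'.2 == z.2)) (fun _ _ => 1%N)) /=.
    apply: leq_trans (_ : \sum_(z in M) (2 * n) <= _)%N; last first.
      by rewrite sum_nat_const leq_mul2r M2r orbT.
    apply: leq_sum => z _; rewrite sum1_card.
    have sub : [pred z' : 'I_n * 'I_n | (z'.1 == z.1) || (z'.2 == z.2)] \subset
        setX [set z.1] setT :|: setX setT [set z.2].
      by apply/subsetP=> z'; rewrite !inE andbT.
    apply: leq_trans (subset_leq_card sub) _; apply: leq_trans (leq_card_setU _ _) _.
    by rewrite !cardsX !cards1 !cardsT card_ord; lia.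
  apply: le_trans (_ : (2 * r * (2 * n))%:R * b <= _).
    by rewrite ler_wpM2r // ler_nat.
  rewrite /b exprS invfM !mulrA ler_pdivrMr ?exprn_gt0 //.
  move: small; move: (union_constant r) => c; rewrite !natrM => small.
  rewrite [leLHS](_ : _ = 4^-1 * (64%:R * r%:R * c%:R * W * K)); first by rewrite ler_wpM2l ?invr_ge0.
  by field; rewrite gt_eqF.
- have [iM _ Mn _] := badP M MF.
  rewrite /p ler_pdivlMl ?ltr0n ?ffact_gt0 // -natrM ler_nat mulnC.
  by have := card_extends_avoid iM nt; rewrite card_ord.
exists s => e e' eE e'E ee'; apply/negP=> cfe.
(* If a conflict survived, the graph of [s] on the two edges would be a member of [bad] that [s]
   extends. *)
pose M := [set (x, s x) | x in ed e :|: ed e'].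
have : M \in bad.
  rewrite inE; apply/andP; split.
    apply/partial_injectionP=> _ _ /imsetP[x _ ->] /imsetP[y _ ->] /= [->//|].
    by move/perm_inj ->.
  apply/existsP; exists (e, e'); apply/existsP; exists (s @: ed e, s @: ed e').
  rewrite /pairE /pairF /box /= eE e'E ee' cfe !card_imset ?card_ed ?eqxx //=;
    try exact: perm_inj; last by move=> x y [].
  rewrite andbT; apply/subsetP=> _ /imsetP[x xe ->]; rewrite inE /= xe /=.
  by rewrite -imsetU imset_f.
move/hs; rewrite inE => /extendsP; case=> _ /imsetP[x _ ->] //.
Qed.

End ConflictFree.

(** * Double counting of degrees and overlaps *)

Lemma card_bigcup_leq (I T : finType) (P : pred I) (A : I -> {set T}) :
  (#|\bigcup_(i | P i) A i| <= \sum_(i | P i) #|A i|)%N.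
Proof.
elim/big_rec2: _ => [|i s S _ IH]; first by rewrite cards0.
by apply: leq_trans (leq_card_setU _ _) _; rewrite leq_add2l.
Qed.

Section Degrees.
Variables (T : finType) (G : hypergraph T) (r n : nat).
Hypothesis unifG : uniform r G.
Hypothesis verts_le : (#|verts G| <= n)%N.

(** Sets not inside [verts G], over which [max_degree] does not range, have degree 0. *)
Lemma degree_max (S : {set T}) : (degree G S <= max_degree #|S| G)%N.
Proof.
have [SV|SV] := boolP (S \subset verts G); first by apply: leq_bigmax_cond; rewrite SV eqxx.
rewrite [degree _ _]eq_card0 // => e; rewrite !inE; apply/negP=> /andP[eE Se].
by case/negP: SV; apply: subset_trans Se (edges_sub eE).
Qed.

(** Induction on [l - #|S|]: an edge containing [S] has a further vertex while [#|S| < r], so adding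
    one of at most [n] vertices costs a factor [n]. *)
Lemma degree_le_expn l (S : {set T}) : (l <= r)%N -> (#|S| <= l)%N -> (0 < n)%N ->
  (n ^ #|S| * degree G S <= n ^ l * max_degree l G)%N.
Proof.
move=> lr + n0; have [m] := ubnP (l - #|S|)%N.
elim: m S => // m IH S Sm; rewrite leq_eqVlt => /orP[/eqP SE|Sl].
  by rewrite -SE leq_mul2l degree_max orbT.
have dS : (degree G S <= \sum_(v in verts G :\: S) degree G (v |: S))%N.
  apply: leq_trans (card_bigcup_leq _ _); apply: subset_leq_card.
  apply/subsetP=> e; rewrite inE => /andP[eE Se].
  have : (0 < #|e :\: S|)%N.
    by rewrite cardsD (setIidPr Se) (unifG eE) subn_gt0 (leq_trans Sl).
  case/card_gt0P=> v; rewrite inE => /andP[vS ve]; apply/bigcupP; exists v.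
    by rewrite inE vS (subsetP (edges_sub eE)).
  by rewrite inE eE subUset sub1set ve Se.
rewrite -(leq_pmul2l n0) mulnA -expnS.
apply: leq_trans (leq_mul (leqnn _) dS) _; rewrite big_distrr /=.
apply: leq_trans (_ : \sum_(v in verts G :\: S) (n ^ l * max_degree l G) <= _)%N.
  apply: leq_sum => v; rewrite inE => /andP[vS _].
  have cvS : #|v |: S| = #|S|.+1 by rewrite cardsU1 vS.
  by rewrite -cvS; apply: IH; rewrite cvS //; lia.
rewrite sum_nat_const leq_mul2r; apply/orP; right.
by apply: leq_trans verts_le; apply: subset_leq_card; apply: subsetDl.
Qed.

(** Otherwise [l.+1] common vertices would have degree at least 2. *)
Lemma card_edgeI l (e e' : {set T}) : max_degree l.+1 G = 1%N ->
  e \in edges G -> e' \in edges G -> e != e' -> (#|e :&: e'| <= l)%N.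
Proof.
move=> D1 eE e'E ee'; rewrite leqNgt; apply/negP=> lt.
pose S := [set x in take l.+1 (enum (e :&: e'))].
have cS : #|S| = l.+1.
  rewrite cardsE (card_uniqP _) ?take_uniq ?enum_uniq // size_take -cardE.
  by case: ltnP => // le; apply/eqP; rewrite eqn_leq le.
have SI : S \subset e :&: e'.
  by apply/subsetP=> x; rewrite inE => /mem_take; rewrite mem_enum.
have := degree_max S; rewrite cS D1 leqNgt => /negP; apply.
apply: leq_trans (_ : #|[set e; e']| <= _)%N; first by rewrite cards2 ee'.
move: SI; rewrite subsetI => /andP[Se Se'].
by apply: subset_leq_card; apply/subsetP=> f; rewrite !inE => /orP[] /eqP ->;
  rewrite ?eE ?e'E.
Qed.

(** Group the edges [e'] by [S = e :&: e']: at most [2 ^ r] sets [S] occur, and [degree_le_expn]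
    bounds the contribution of each. *)
Lemma edge_overlap_sum l (e : {set T}) : (l <= r)%N -> (0 < n)%N -> max_degree l.+1 G = 1%N ->
  e \in edges G ->
  (\sum_(e' in edges G | e != e') n ^ #|e :&: e'| <= 2 ^ r * (n ^ l * max_degree l G))%N.
Proof.
move=> lr n0 D1 eE.
rewrite (partition_big (fun e' => e :&: e') (fun S => (S \in powerset e) && (#|S| <= l)%N))
  => [|e' /andP[e'E ee']]; last by rewrite powersetE subsetIl (card_edgeI D1).
apply: leq_trans (_ : \sum_(S in powerset e) (n ^ l * max_degree l G) <= _)%N; last first.
  by rewrite sum_nat_const card_powerset (unifG eE).
rewrite big_mkcondr /=; apply: leq_sum => S _; case: ifP => // Sl.
apply: leq_trans (degree_le_expn lr Sl n0).
apply: leq_trans (_ : \sum_(e' in [set f in edges G | S \subset f]) n ^ #|S| <= _)%N.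
  rewrite big_mkcond [leqRHS]big_mkcond; apply: leq_sum => e' _ /=.
  case: ifP => // /andP[/andP[e'E _] /eqP <-].
  by rewrite inE e'E subsetIr.
by rewrite sum_nat_const mulnC.
Qed.

(** Edges whose image contains [x] all pass through one preimage vertex, so there are at most
    [max_degree 1 G] of them; a point [x] on no image gives an empty sum. *)
Lemma embedded_overlap_sum (V : finType) (g : T -> V) l x :
  {in verts G &, injective g} -> (l <= r)%N -> (0 < n)%N -> max_degree l.+1 G = 1%N ->
  (\sum_(e in edges G | x \in g @: (e : {set T}))
     \sum_(e' in edges G | e != e') n ^ #|g @: e :&: g @: e'|
   <= max_degree 1 G * (2 ^ r * (n ^ l * max_degree l G)))%N.
Proof.
move=> injg lr n0 D1.
have [e0 /andP[e0E /imsetP[v ve0 xE]]|none] :=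
  pickP [pred e : {set T} | (e \in edges G) && (x \in g @: e)]; last by rewrite big_pred0.
have eV e : e \in edges G -> {subset e <= verts G}.
  by move=> eE; apply/subsetP/edges_sub.
apply: leq_trans (_ : \sum_(e in [set f in edges G | [set v] \subset f])
    2 ^ r * (n ^ l * max_degree l G) <= _)%N; last first.
  by rewrite sum_nat_const leq_mul2r -(cards1 v) degree_max orbT.
rewrite big_mkcond [leqRHS]big_mkcond; apply: leq_sum => e _ /=.
case: ifP => // /andP[eE /imsetP[w we]]; rewrite xE => /injg vw.
have {}vw : v = w by apply: vw; [apply: (eV e0) | apply: (eV e)].
rewrite inE eE sub1set vw we /=.
apply: leq_trans (edge_overlap_sum lr n0 D1 eE).
rewrite leq_eqVlt; apply/orP; left; apply/eqP; apply: eq_bigr => e' /andP[e'E _].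
rewrite -imsetI => [|a b /(eV _ eE) aV /(eV _ e'E) bV]; last exact: injg.
rewrite card_in_imset // => a b /setIP[/(eV _ eE) aV _] /setIP[/(eV _ eE) bV _].
exact: injg.
Qed.

End Degrees.

(** * Embedding [G] and choosing the constants *)

Lemma exists_injection_ord (T : finType) (A : {set T}) n :
  (0 < n)%N -> (#|A| <= n)%N -> exists g : T -> 'I_n, {in A &, injective g}.
Proof.
case: n => // n _ An; exists (fun x => inord (index x (enum A))) => x y xA yA.
have idx z : z \in A -> (index z (enum A) < n.+1)%N.
  by move=> zA; apply: leq_trans An; rewrite cardE index_mem mem_enum.
move/(congr1 (@nat_of_ord _)); rewrite !inordK ?idx //.
by apply: (index_inj x); rewrite mem_enum.
Qed.

(** The common core of (i) and (ii), which differ only in [cf] and in the bound on its conflicts. *)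
Lemma exists_conflict_free_copy (R : realFieldType) (r l n : nat) (T : finType)
    (G : hypergraph T) (cf : rel {set 'I_n}) (K : R) :
  (0 < r)%N -> (l <= r)%N -> (0 < n)%N -> (#|verts G| <= n)%N -> uniform r G ->
  max_degree l.+1 G = 1%N -> symmetric cf ->
  (forall f : {set 'I_n}, #|f| = r ->
     #|[set f' : {set 'I_n} | (#|f'| == r) && cf f f']|%:R <= K) ->
  (64 * r * union_constant r)%:R *
    (max_degree 1 G * (2 ^ r * (n ^ l * max_degree l G)))%:R * K <= n%:R ^+ r ->
  exists F, copy_in G (complete_hypergraph r n) F /\
    {in edges F &, forall f f', f != f' -> ~~ cf f f'}.
Proof.
move=> r0 lr n0 Gn unifG D1 cf_sym cfK small.
have [g injg] := exists_injection_ord n0 Gn.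
have eV e : e \in edges G -> {subset e <= verts G}.
  by move=> eE; apply/subsetP/edges_sub.
(* [max_degree l.+1 G = 1] forces [G] to have an edge, whose [r] vertices are among at most [n]. *)
have rn : (r <= n)%N.
  have [/eqP E0|[e eE]] := set_0Vmem (edges G).
    suff : max_degree l.+1 G = 0%N by rewrite D1.
    rewrite /max_degree big1 // => S _; apply: eq_card0 => e.
    by rewrite !inE (eqP E0) inE.
  by rewrite -(unifG _ eE); apply: leq_trans Gn; apply/subset_leq_card/edges_sub.
have card_g e : e \in edges G -> #|g @: e| = r.
  move=> eE; rewrite card_in_imset ?unifG // => a b /(eV _ eE) aV /(eV _ eE) bV.
  exact: injg.
have [|s hs] := exists_conflict_free_perm r0 card_g cf_sym cfK _ rn small.
  move=> x; have := embedded_overlap_sum unifG Gn x injg lr n0 D1.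
  rewrite -(ler_nat R) natr_sum; congr (_ <= _); apply: eq_bigr => e _.
  by rewrite natr_sum; apply: eq_bigr => e' _; rewrite natrX.
have Fsub f : f \in [set (s \o g) @: (e : {set T}) | e in edges G] ->
    f \subset (s \o g) @: verts G.
  by case/imsetP=> e eE ->; apply/imsetS/edges_sub.
exists (Hypergraph Fsub); split; first split.
- split; first exact: subsetT.
  apply/subsetP=> _ /imsetP[e eE ->]; rewrite inE imset_comp card_imset ?card_g //.
  exact: perm_inj.
- by exists (s \o g); split=> // a b aV bV /perm_inj; apply: injg.
move=> _ _ /imsetP[e eE ->] /imsetP[e' e'E ->] ne.
rewrite (imset_comp s g e) (imset_comp s g e'); apply: hs => //.
by apply: contraNneq ne => ->.
Qed.

Theorem theorem1p9 (R : realType) (r l : nat) (hr : (2 <= r)%N)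
    (hl : (1 <= l <= r - 1)%N) :
  exists c1 c2 : R, [/\ 0 < c1, 0 < c2 &
    forall (n : nat) (T : finType) (G : hypergraph T),
      (0 < n)%N -> (#|verts G| <= n)%N -> uniform r G ->
      max_degree l.+1 G = 1%N ->
      (forall c : coloring 'I_n,
         locally_bounded
           (c1 * n%:R ^+ (r - l) / ((max_degree 1 G)%:R * (max_degree l G)%:R))
           (complete_hypergraph r n) c ->
         G_proper G (complete_hypergraph r n) c) /\
      (forall c : coloring 'I_n,
         globally_bounded
           (c2 * n%:R ^+ (r - l) / ((max_degree 1 G)%:R * (max_degree l G)%:R))
           (complete_hypergraph r n) c ->
         G_rainbow G (complete_hypergraph r n) c)].
Proof.
have r0 : (0 < r)%N by lia.
have lr : (l <= r)%N by lia.
(* The inverse of the constants in [exists_conflict_free_copy], with one more [r] because the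
   conflict bound supplied is [r * k]. *)
pose c : R := ((64 * r * union_constant r) * (2 ^ r * r))%:R^-1.
have c0 : 0 < c by rewrite invr_gt0 ltr0n !muln_gt0 !expn_gt0 muln_gt0 r0.
exists c, c; split=> // n T G n0 Gn unifG D1.
set k := _ / _.
have k0 : 0 <= k by rewrite divr_ge0 ?mulr_ge0 ?exprn_ge0 ?ler0n // ltW.
have small : (64 * r * union_constant r)%:R *
    (max_degree 1 G * (2 ^ r * (n ^ l * max_degree l G)))%:R * (r%:R * k) <= n%:R ^+ r.
  pose x : R := (max_degree 1 G)%:R * (max_degree l G)%:R.
  (* The inequality also covers [x = 0], where the quotient is 0 by convention. *)
  have x1 : x / x <= 1.
    by have [->|x0] := eqVneq x 0; rewrite ?mul0r // divff.
  rewrite [leLHS](_ : _ = n%:R ^+ r * (x / x)); first by rewrite ler_piMr ?exprn_ge0.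
  rewrite -[in RHS](subnK lr) exprD /k -/x.
  have : c * ((64 * r * union_constant r) * (2 ^ r * r))%:R = 1.
    by rewrite mulVf // gt_eqF // -invr_gt0.
  move: (64 * r * union_constant r)%N => u; rewrite !natrM natrX natrX => cE.
  transitivity ((c * (u%:R * (2 ^+ r * r%:R))) * (n%:R ^+ (r - l) * n%:R ^+ l * (x / x))).
    by rewrite /x; ring.
  by rewrite cE mul1r.
have conflict_free (cf : rel {set 'I_n}) cf_sym cf_bound :=
  exists_conflict_free_copy (cf := cf) r0 lr n0 Gn unifG D1 cf_sym cf_bound small.
split=> col bnd.
- have [|f fr|F [FG hF]] :=
    conflict_free (fun f f' => (f :&: f' != set0) && (col f == col f')).
  + by move=> f f'; rewrite setIC [col f == _]eq_sym.
  (* A conflicting set shares one of the [r] vertices of [f], and each vertex lies in at most [k]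
     sets of that colour. *)
  + apply: le_trans (_ : (\sum_(v in f)
        #|[set e in edges (complete_hypergraph r n) | (v \in e) && (col e == col f)]|)%:R <= _).
      rewrite ler_nat; apply: leq_trans (card_bigcup_leq _ _).
      apply: subset_leq_card; apply/subsetP=> f'.
      rewrite inE => /and3P[f'r /set0Pn[v /setIP[vf vf']] /eqP cE].
      by apply/bigcupP; exists v => //; rewrite !inE f'r vf' cE eqxx.
    rewrite natr_sum; apply: le_trans (ler_sum _ (fun v _ => bnd v (col f) (in_setT v))) _.
    by rewrite sumr_const fr mulr_natl.
  exists F; split=> // e e' eF e'F /eqP ee' /eqP eI ce.
  by have := hF e e' eF e'F ee'; rewrite eI ce eqxx.
- have [|f fr|F [FG hF]] := conflict_free (fun f f' => col f == col f').
  + by move=> f f'; rewrite eq_sym.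
  (* Here a colour class has at most [k] sets, and [k <= r * k], so the same constant serves. *)
  + apply: le_trans (_ : k <= _); last by rewrite ler_peMl // ler1n.
    apply: le_trans (bnd (col f)); rewrite ler_nat subset_leq_card //.
    by apply/subsetP=> f'; rewrite !inE [col f' == _]eq_sym.
  exists F; split=> // e e' eF e'F /eqP ee' ce.
  by have := hF e e' eF e'F ee'; rewrite ce eqxx.
Qed.
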